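(* Let $f\in L^2(\mathbb{R}^2)$, let $\lambda_0>0$ and $\lambda_n=\lambda_0 2^n$ for $n\in\mathbb{N}=\{0,1,2,\dots\}$. Let $u_0$ be the unique minimizer of $$\min\left\{\lambda_0\|f-u\|_{L^2(\mathbb{R}^2)}^2+\|u\|_{BV(\mathbb{R}^2)}:\ u\in L^2(\mathbb{R}^2)\right\}$$ and, inductively for $n\geq 1$, let $u_n$ be the unique minimizer of $$\min\left\{\lambda_n\|f-u_0-\cdots-u_{n-1}-u\|_{L^2(\mathbb{R}^2)}^2+\|u\|_{BV(\mathbb{R}^2)}:\ u\in L^2(\mathbb{R}^2)\right\}.$$ Then $$f=\sum_{j=0}^{+\infty}u_j$$ with convergence in the strong sense in $L^2(\mathbb{R}^2)$, and $$\|f\|_{L^2(\mathbb{R}^2)}^2=\sum_{j=0}^{+\infty}\left[\frac{1}{\lambda_j}\|u_j\|_{BV(\mathbb{R}^2)}+\|u_j\|_{L^2(\mathbb{R}^2)}^2\right].$$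
   Context: $BV(\mathbb{R}^2)$ is the homogeneous $BV$ space: functions $u$ whose distributional gradient $Du$ is a bounded vector-valued Radon measure on $\mathbb{R}^2$ and which vanish at infinity in a weak sense (which is guaranteed if $u\in L^2(\mathbb{R}^2)$). Its norm is the total variation $\|u\|_{BV(\mathbb{R}^2)}=|Du|(\mathbb{R}^2)$; for $u\in L^2(\mathbb{R}^2)\setminus BV(\mathbb{R}^2)$ one sets $\|u\|_{BV(\mathbb{R}^2)}=+\infty$. The minimization problems in the claim are known to have unique solutions. *)

(* Defs.v *)
From HB Require Import structures.
From mathcomp Require Import all_boot all_order all_algebra.
From mathcomp Require Import all_classical all_reals all_analysis.

Set Implicit Arguments.
Unset Strict Implicit.
Unset Printing Implicit Defensive.

Import Order.TTheory GRing.Theory Num.Theory.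
Import numFieldNormedType.Exports.

Local Open Scope classical_set_scope.
Local Open Scope ring_scope.

(* [measurableTypeR R] is convertible to R; it is the type on which
   [lebesgue_measure] lives.  The product sigma-algebra of two copies of it is
   the Borel sigma-algebra of R^2. *)
Notation plane R := (measurableTypeR R * measurableTypeR R)%type.

Definition lebesgue2 (R : realType) : {measure set (plane R) -> \bar R} :=
  ((@lebesgue_measure R) \x (@lebesgue_measure R))%E.

(* Elements of L^2(R^2) are given by representatives. *)
Definition L2 (R : realType) : {pred plane R -> R} :=
  Lfun (lebesgue2 R) 2%:E.

Definition L2norm (R : realType) (g : plane R -> R) : \bar R :=
  'N[lebesgue2 R]_2%:E [EFin \o g]%E.

Definition e1 (R : realType) : R * R := (1, 0).
Definition e2 (R : realType) : R * R := (0, 1).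

Fixpoint Ck (R : realType) (k : nat) (phi : R * R -> R) : Prop :=
  match k with
  | 0 => continuous phi
  | k'.+1 => [/\ continuous phi,
      forall x, derivable phi x (e1 R), forall x, derivable phi x (e2 R),
      Ck k' ('D_(e1 R) phi) & Ck k' ('D_(e2 R) phi)]
  end.

Definition test_function (R : realType) (phi : R * R -> R) : Prop :=
  (forall k, Ck k phi) /\ compact (closure [set x | phi x != 0]).

(* The integral of f with respect to a finite signed measure nu is
   int f d(nu^+) - int f d(nu^-), where nu = nu^+ - nu^- is the Jordan
   decomposition.  The latter does not depend on the Hahn decomposition (P, N)
   selected here, by [Hahn_decomposition_uniq]. *)
Definition charge_Rintegral d (T : measurableType d) (R : realType)
    (nu : {charge set T -> \bar R}) (f : T -> R) : R :=
  let P := projT1 (cid (Hahn_decomposition nu)) in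
  let exN := projT2 (cid (Hahn_decomposition nu)) in
  let N := projT1 (cid exN) in
  let nuPN : hahn_decomposition nu P N := projT2 (cid exN) in
  \int[jordan_pos nuPN]_x f x - \int[jordan_neg nuPN]_x f x.

(* The finite R^2-valued Borel measure (nu1, nu2) is the distributional gradient
   of u.  Charges are finite-valued, and on R^2 a finite Borel measure is
   Radon. *)
Definition distributional_gradient (R : realType) (u : plane R -> R)
    (nu1 nu2 : {charge set (plane R) -> \bar R}) : Prop :=
  forall phi : R * R -> R, test_function phi ->
    \int[lebesgue2 R]_x (u x * 'D_(e1 R) phi x) = - charge_Rintegral nu1 phi /\
    \int[lebesgue2 R]_x (u x * 'D_(e2 R) phi x) = - charge_Rintegral nu2 phi.

(* |(nu1, nu2)|(T): the supremum, over countable measurable partitions (E_k) of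
   T, of the sum of the Euclidean norms of (nu1(E_k), nu2(E_k)). *)
Definition total_variation2 d (T : measurableType d) (R : realType)
    (nu1 nu2 : {charge set T -> \bar R}) : \bar R :=
  ereal_sup [set (\sum_(0 <= k <oo)
      (Num.sqrt (fine (nu1 (E k)) ^+ 2 + fine (nu2 (E k)) ^+ 2))%:E)%E |
    E in [set E : (set T)^nat | [/\ forall k, measurable (E k),
      trivIset setT E & \bigcup_k E k = setT]]].

(* |Du|(R^2) if Du is a finite Radon measure, and +oo (the infimum of the empty
   set) otherwise.  Since Du is unique when it exists, the infimum is taken over
   at most one value.  Only meant for u in L^2(R^2), so that the condition of
   vanishing at infinity is automatic. *)
Definition BVnorm (R : realType) (u : plane R -> R) : \bar R :=
  ereal_inf [set tv | exists nu1 nu2 : {charge set (plane R) -> \bar R},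
    distributional_gradient u nu1 nu2 /\ tv = total_variation2 nu1 nu2].

Definition functional (R : realType) (lambda : R) (g v : plane R -> R)
    : \bar R :=
  (lambda%:E * L2norm (g - v)%R ^+ 2 + BVnorm v)%E.

Definition is_minimizer (R : realType) (lambda : R) (g u : plane R -> R)
    : Prop :=
  u \in @L2 R /\
  forall v, v \in @L2 R -> (functional lambda g u <= functional lambda g v)%E.

(* Main.v *)
Require Import Defs.
From HB Require Import structures.
From mathcomp Require Import all_boot all_order all_algebra.
From mathcomp Require Import all_classical all_reals all_analysis.
From mathcomp Require Import measurable_realfun lra ring.

Set Implicit Arguments.
Unset Strict Implicit.
Unset Printing Implicit Defensive.

Import Order.TTheory GRing.Theory Num.Theory.
Import numFieldNormedType.Exports.

Local Open Scope classical_set_scope.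
Local Open Scope ring_scope.

(* Put r_n = f - u_0 - ... - u_(n-1), lambda_n = lambda_0 2^n and
   a_n = |u_n|_BV / lambda_n.

   Comparing u_n with its multiples (1 + t) u_n gives
   |u_n|_BV = 2 lambda_n <r_(n+1), u_n>, that is
   |r_n|^2 = |r_(n+1)|^2 + a_n + |u_n|^2, and these identities telescope.  In
   particular the series of the a_n is bounded by |f|^2.

   Comparing u_n with v - u_0 - ... - u_(n-1), where v is a BV function near f,
   gives |r_(n+1)|^2 <= |f - v|^2 + c_n with
   c_n = (|v|_BV + sum_(j < n) |u_j|_BV) / lambda_n.  Since lambda_n doubles,
   2 c_(n+1) = c_n + a_n, so the series of the c_n is bounded too and c_n tends
   to 0.  Hence r_n tends to 0, because BV functions are dense in L^2: the
   indicator function of a rectangle is BV by Fubini and the fundamental theorem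
   of calculus, and Dynkin's theorem leads from rectangles to bounded measurable
   sets, thence to simple functions. *)

(** * Continuous functions on the plane and integrals against charges *)

(** An open set is the union of the open boxes with rational corners that it contains, and these are
    countably many. *)
Lemma open_measurable_plane (R : realType) (U : set (R * R)) :
  open U -> measurable (U : set (plane R)).
Proof.
move=> oU.
pose box a b c d : set (R * R) :=
  (`]ratr a, ratr b[ : set R) `*` (`]ratr c, ratr d[ : set R).
(* Boxes that leave [U] are replaced by the empty set, so that the union runs over all quadruples of
   rationals. *)
pose F (a b c d : rat) : set (plane R) :=
  if pselect (box a b c d `<=` U) then box a b c d else set0.
rewrite (_ : U = \bigcup_a \bigcup_b \bigcup_c \bigcup_d F a b c d).
  apply: bigcupT_measurable_rat => a; apply: bigcupT_measurable_rat => b.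
  apply: bigcupT_measurable_rat => c; apply: bigcupT_measurable_rat => d.
  rewrite /F; case: pselect => ?; last exact: measurable0.
  by apply: measurableX; exact: measurable_itv.
apply/seteqP; split => [[x y] Uxy|[x y] [a _ [b _ [c _ [d _]]]]]; last first.
  by rewrite /F; case: pselect => // => sU /sU.
have /nbhs_ballP[e /= e0 eU] : nbhs (x, y) U by exact: open_nbhs_nbhs.
have rat_around (z : R) : exists a b : rat,
    [/\ z - e < ratr a, ratr a < z, z < ratr b & ratr b < z + e].
  have [a] : exists a : rat, ratr a \in `]z - e, z[.
    by apply: rat_in_itvoo; lra.
  rewrite in_itv /= => /andP[? ?].
  have [b] : exists b : rat, ratr b \in `]z, z + e[.
    by apply: rat_in_itvoo; lra.
  by rewrite in_itv /= => /andP[? ?]; exists a, b.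
have [a [b [a1 a2 b1 b2]]] := rat_around x.
have [c [d [c1 c2 d1 d2]]] := rat_around y.
exists a => //; exists b => //; exists c => //; exists d => //.
rewrite /F; case: pselect => [?|].
  by split => /=; rewrite in_itv /=; apply/andP.
case=> -[s t] [/=]; rewrite !in_itv /= => /andP[? ?] /andP[? ?]; apply: eU.
by split; rewrite /= /ball /= ltr_norml; apply/andP; split; lra.
Qed.

Lemma continuous_measurable_plane (R : realType) (phi : R * R -> R) :
  continuous phi -> measurable_fun [set: plane R] phi.
Proof.
move=> /continuousP cphi.
apply: (measurability _ (RGenOpens.measurableE R)).
move=> _ [_ [a [b ->] <-]]; rewrite setTI.
by apply: open_measurable_plane; apply: cphi; exact: interval_open.
Qed.

(** The Hahn decomposition inside [charge_Rintegral] comes from a choice. This lemma frees the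
    integral from it: any splitting of [nu] into two finite measures gives the same value. *)
Lemma charge_RintegralE d (T : measurableType d) (R : realType)
    (nu : {charge set T -> \bar R})
    (m1 m2 : {measure set T -> \bar R}) (f : T -> R) :
  fin_num_fun m1 -> fin_num_fun m2 ->
  (forall A, measurable A -> nu A = (m1 A - m2 A)%E) ->
  measurable_fun setT f -> [bounded f x | x in setT] ->
  charge_Rintegral nu f = \int[m1]_x f x - \int[m2]_x f x.
Proof.
move=> fm1 fm2 nuE mf bf; rewrite /charge_Rintegral.
set P := projT1 (cid _); set exN := projT2 (cid (Hahn_decomposition nu)).
set N := projT1 (cid exN); set nuPN : hahn_decomposition nu P N := projT2 (cid exN).
have fi (mu : {measure set T -> \bar R}) :
    fin_num_fun mu -> mu.-integrable setT (EFin \o f).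
  by move=> fmu; apply: measurable_bounded_integrable => //; rewrite ltey_eq fmu.
pose jp := [the {measure set T -> \bar R} of jordan_pos nuPN].
pose jn := [the {measure set T -> \bar R} of jordan_neg nuPN].
have fjp : fin_num_fun jp by exact: fin_num_measure.
have fjn : fin_num_fun jn by exact: fin_num_measure.
(* From [jp - jn = m1 - m2] follows [jp + m2 = m1 + jn], an equality of positive measures that can
   be integrated. *)
have E : (\int[measure_add jp m2]_x (EFin \o f) x =
          \int[measure_add m1 jn]_x (EFin \o f) x)%E.
  apply: eq_measure_integral => A mA _.
  change (measure_add jp m2 A = measure_add m1 jn A); rewrite !measure_addE.
  have := nuE A mA; rewrite (jordan_decomp nuPN mA) /cadd /= /cscale /=.
  rewrite -/jp -/jn.
  rewrite -(fineK (fjp A mA)) -(fineK (fjn A mA)).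
  rewrite -(fineK (fm1 A mA)) -(fineK (fm2 A mA)).
  by rewrite -!EFinB -!EFinD => -[H]; congr EFin; move: H; lra.
move: E; rewrite !integral_measure_add //; [|exact: fi..].
rewrite /Rintegral -/jp -/jn.
have fin (mu : {measure set T -> \bar R}) : fin_num_fun mu ->
    (\int[mu]_x (EFin \o f) x)%E \is a fin_num.
  by move=> fmu; apply: integrable_fin_num => //; exact: fi.
rewrite -(fineK (fin _ fjp)) -(fineK (fin _ fjn)).
rewrite -(fineK (fin _ fm1)) -(fineK (fin _ fm2)).
rewrite /= -!EFinD => -[]; lra.
Qed.

(** * Square-integrable functions and test functions *)

Section Lfun2.
Context d (T : measurableType d) (R : realType) (mu : {measure set T -> \bar R}).

Lemma Lnorm2_sqr (g : T -> R) :
  ('N[mu]_2%:E[EFin \o g] ^+ 2 = \int[mu]_x (g x ^+ 2)%:E)%E.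
Proof.
have := @powR_Lnorm _ _ _ mu (EFin \o g) 2.
rewrite pnatr_eq0 => /(_ isT).
under [X in _ = X -> _]eq_integral => x _ /=.
  rewrite powR_mulrn // -normrX ger0_norm ?sqr_ge0 //; over.
move=> <-.
have := @Lnorm_ge0 _ _ _ mu 2%:E (EFin \o g).
case: ('N[mu]_2%:E[EFin \o g])%E => [r| |] r0 //.
- by rewrite -EFin_expe /= powR_mulrn.
- by rewrite poweRyr ?pnatr_eq0 // expe2 mulyy.
Qed.

Lemma Lfun2P (g : T -> R) :
  g \in Lfun mu 2%:E <->
  measurable_fun setT g /\ (\int[mu]_x (g x ^+ 2)%:E < +oo)%E.
Proof.
rewrite -Lnorm2_sqr; split.
  move=> gL; split; first by move: gL; rewrite inE => /andP[/set_mem].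
  move: gL; rewrite inE => /andP[_ /set_mem]; rewrite /= /finite_norm.
  have := @Lnorm_ge0 _ _ _ mu 2%:E (EFin \o g).
  by case: ('N[mu]_2%:E[EFin \o g])%E => [r _ _| |]; rewrite -?EFin_expe ?ltry ?ltxx.
move=> [mg fg]; rewrite inE; apply/andP; split; rewrite inE //= /finite_norm.
move: fg; have := @Lnorm_ge0 _ _ _ mu 2%:E (EFin \o g).
by case: ('N[mu]_2%:E[EFin \o g])%E => [r| |] //; rewrite ?ltry // expe2 mulyy.
Qed.

Lemma Lfun2_measurable (g : T -> R) :
  g \in Lfun mu 2%:E -> measurable_fun setT g.
Proof. by move=> /Lfun2P[]. Qed.

Lemma Lnorm2_sqr_Rintegral (g : T -> R) : g \in Lfun mu 2%:E ->
  ('N[mu]_2%:E[EFin \o g] ^+ 2 = (\int[mu]_x (g x ^+ 2))%:E)%E.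
Proof.
move=> gL; rewrite Lnorm2_sqr /Rintegral fineK //.
by apply: integrable_fin_num => //; exact: Lfun2_integrable_sqr.
Qed.

Lemma Lfun2_mul_integrable (g h : T -> R) :
  g \in Lfun mu 2%:E -> h \in Lfun mu 2%:E ->
  mu.-integrable setT (EFin \o (fun x => g x * h x)).
Proof. by move=> gL hL; exact/Lfun1_integrable/Lfun2_mul_Lfun1. Qed.

Lemma bounded_Lfun2 (g : T -> R) (A : set T) (M : R) :
  measurable A -> (mu A < +oo)%E -> measurable_fun setT g ->
  (forall x, `|g x| <= M) -> (forall x, ~ A x -> g x = 0) ->
  g \in Lfun mu 2%:E.
Proof.
move=> mA Aoo mg gM gA; apply/Lfun2P; split=> //.
rewrite (@le_lt_trans _ _ (\int[mu]_x ((M ^+ 2)%:E * (\1_A x)%:E))%E) //.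
  apply: ge0_le_integral => //.
  - by move=> x _; rewrite lee_fin sqr_ge0.
  - by apply/measurable_EFinP; exact: measurable_funX.
  - by apply/measurable_EFinP; apply: measurable_funM.
  - move=> x _; rewrite -EFinM lee_fin indicE.
    have [xA|xA] := boolP (x \in A); last first.
      by rewrite gA ?expr0n ?mulr0//; move: xA; rewrite notin_setE.
    rewrite mulr1 -real_normK ?num_real // lerXn2r ?nnegrE //.
    exact: le_trans (normr_ge0 _) (gM x).
rewrite ge0_integralZl_EFin ?sqr_ge0 //.
- by rewrite integral_indic // setIT lte_mul_pinfty // lee_fin sqr_ge0.
- by apply/measurable_EFinP.
Qed.

End Lfun2.

Lemma lee1_2 (R : realType) : (1 <= 2%:E :> \bar R)%E.
Proof. by rewrite lee_fin ler1n. Qed.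

Lemma lebesgue2X (R : realType) (A B : set (measurableTypeR R)) :
  measurable A -> measurable B ->
  (lebesgue2 R (A `*` B) = lebesgue_measure A * lebesgue_measure B)%E.
Proof. exact: product_measure1E. Qed.

Section test_functions.
Variable R : realType.
Implicit Types (g phi : R * R -> R) (K : set (R * R)).

Lemma compact_measurable_plane K : compact K -> measurable (K : set (plane R)).
Proof.
move=> cK; rewrite -(setCK K); apply: measurableC.
apply: open_measurable_plane; rewrite openC.
by apply: compact_closed => //; exact: norm_hausdorff.
Qed.

Lemma compact_lebesgue2_lty K : compact K -> (lebesgue2 R K < +oo)%E.
Proof.
move=> cK; have [M [Mr KM]] := compact_bounded cK.
(* [compact_bounded] gives a bound only for reals strictly above [M], hence the added 1. *)
pose N := `|M| + 1; have {}KM x : K x -> `|x| <= N.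
  by apply: KM; rewrite /N (le_lt_trans (ler_norm M)) // ltrDl.
pose I : set (measurableTypeR R) := `[- N, N]%classic.
have mI : measurable I by exact: measurable_itv.
rewrite (@le_lt_trans _ _ (lebesgue2 R (I `*` I))) //.
  apply: le_measure; rewrite ?inE.
  - exact: compact_measurable_plane.
  - exact: measurableX.
  - move=> [x y] /KM; rewrite prod_normE ge_max /= => /andP[xN yN].
    by split; rewrite /I /= in_itv /= -ler_norml.
rewrite lebesgue2X // lte_mul_pinfty //.
  rewrite ge0_fin_numE // /I lebesgue_measure_itv /=.
  by case: ifP => // _; rewrite -EFinB ltry.
by rewrite /I lebesgue_measure_itv /=; case: ifP => // _; rewrite -EFinB ltry.
Qed.

Lemma continuous_compact_support_bounded g K : continuous g -> compact K ->
  (forall x, ~ K x -> g x = 0) -> exists M, forall x, `|g x| <= M.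
Proof.
move=> cg cK gK.
have cgK : compact (g @` K).
  by apply: continuous_compact => //; exact: continuous_subspaceT.
have [M [Mr KM]] := compact_bounded cgK.
exists (`|M| + 1) => x; have [Kx|nKx] := pselect (K x).
  apply: KM; last by exists x.
  by rewrite (le_lt_trans (ler_norm M)) // ltrDl.
by rewrite gK // normr0 addr_ge0.
Qed.

Lemma continuous_compact_support_L2 g K : continuous g -> compact K ->
  (forall x, ~ K x -> g x = 0) -> g \in @L2 R.
Proof.
move=> cg cK gK; have [M gM] := continuous_compact_support_bounded cg cK gK.
apply: (@bounded_Lfun2 _ (plane R) R (lebesgue2 R) g K M) => //.
- exact: compact_measurable_plane.
- exact: compact_lebesgue2_lty.
- exact: continuous_measurable_plane.
Qed.

Lemma test_function_continuous phi : test_function phi -> continuous phi.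
Proof. by move=> [/(_ 0)]. Qed.

Lemma test_function_support phi : test_function phi ->
  compact (closure [set x | phi x != 0]) /\
  forall x, ~ closure [set x | phi x != 0] x -> phi x = 0.
Proof.
move=> [_ cK]; split=> // x nKx; apply/eqP; apply: contrapT => /negP phix.
by apply: nKx; exact: subset_closure.
Qed.

Lemma test_function_bounded phi : test_function phi ->
  exists M, forall x, `|phi x| <= M.
Proof.
move=> tphi; have [cK Kphi] := test_function_support tphi.
exact: (continuous_compact_support_bounded (test_function_continuous tphi) cK).
Qed.

(** The complement of the support is open, so [phi] coincides with 0 near such an [x]. *)
Lemma derive_support phi (e x : R * R) :
  ~ closure [set x | phi x != 0] x -> 'D_e phi x = 0.
Proof.
set K := closure _ => nKx.
have oK : open (~` K) by rewrite openC; exact: closed_closure.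
have : \near x, phi x = (cst 0 : R * R -> R) x.
  have : nbhs x (~` K) by exact: open_nbhs_nbhs.
  apply: filterS => y nKy; apply/eqP; apply: contrapT => /negP phiy.
  by apply: nKy; exact: subset_closure.
by move=> /near_eq_derive ->; rewrite derive_cst.
Qed.

(** For [u] in L^2 this makes the products in [distributional_gradient] integrable, so that their
    integrals depend linearly on [u]. *)
Lemma test_function_derive_L2 phi : test_function phi ->
  'D_(e1 R) phi \in @L2 R /\ 'D_(e2 R) phi \in @L2 R.
Proof.
move=> tphi; have [cK _] := test_function_support tphi.
have [_ _ _ c1 c2] := tphi.1 1.
by split; apply: (continuous_compact_support_L2 _ cK) => // x; exact: derive_support.
Qed.

End test_functions.

(** * Linearity of the integral in the charge *)

Section charge_Rintegral_linear.
Context d (T : measurableType d) (R : realType).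
Implicit Types (nu : {charge set T -> \bar R}) (f : T -> R).

Lemma charge_RintegralP nu : exists m1 m2 : {measure set T -> \bar R},
  [/\ fin_num_fun m1, fin_num_fun m2,
      forall A, measurable A -> nu A = (m1 A - m2 A)%E &
      forall f, measurable_fun setT f -> [bounded f x | x in setT] ->
        charge_Rintegral nu f = \int[m1]_x f x - \int[m2]_x f x].
Proof.
have [P [N nuPN]] := Hahn_decomposition nu.
pose jp := [the {measure set T -> \bar R} of jordan_pos nuPN].
pose jn := [the {measure set T -> \bar R} of jordan_neg nuPN].
have fjp : fin_num_fun jp by exact: fin_num_measure.
have fjn : fin_num_fun jn by exact: fin_num_measure.
have nuE A : measurable A -> nu A = (jp A - jn A)%E.
  by move=> mA; rewrite (jordan_decomp nuPN mA) /cadd /= /cscale /= mulN1e.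
exists jp, jn; split => // f mf bf.
exact: charge_RintegralE.
Qed.

Lemma bounded_finite_integrable (m : {measure set T -> \bar R}) f :
  fin_num_fun m -> measurable_fun setT f -> [bounded f x | x in setT] ->
  m.-integrable setT (EFin \o f).
Proof.
by move=> fm mf bf; apply: measurable_bounded_integrable; rewrite // ltey_eq fm.
Qed.

(** The pairs of measures are added componentwise. The sums need not be mutually singular, hence
    need not be a Jordan decomposition, and [charge_RintegralE] bridges the gap. *)
Lemma charge_RintegralD nu nu' f :
  measurable_fun setT f -> [bounded f x | x in setT] ->
  charge_Rintegral (cadd nu nu') f =
  charge_Rintegral nu f + charge_Rintegral nu' f.
Proof.
move=> mf bf.
have [m1 [m2 [fm1 fm2 nuE ->]]] := charge_RintegralP nu => //.
have [m1' [m2' [fm1' fm2' nuE' ->]]] := charge_RintegralP nu' => //.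
have madd (m m' : {measure set T -> \bar R}) A :
    [the {measure set T -> \bar R} of measure_add m m'] A = (m A + m' A)%E.
  exact: measure_addE.
rewrite (@charge_RintegralE _ _ _ _ (measure_add m1 m1') (measure_add m2 m2')) //.
- rewrite /Rintegral !integral_measure_add //; [|exact: bounded_finite_integrable..].
  have fin (m : {measure set T -> \bar R}) : fin_num_fun m ->
      (\int[m]_x (EFin \o f) x)%E \is a fin_num.
    by move=> fm; apply: integrable_fin_num => //; exact: bounded_finite_integrable.
  rewrite (fineD (fin _ fm1) (fin _ fm1')) (fineD (fin _ fm2) (fin _ fm2')).
  lra.
- by move=> A mA; rewrite madd fin_numD fm1 // fm1'.
- by move=> A mA; rewrite madd fin_numD fm2 // fm2'.
- move=> A mA; rewrite !madd [LHS](_ : _ = nu A + nu' A)%E // nuE // nuE' //.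
  rewrite -(fineK (fm1 A mA)) -(fineK (fm2 A mA)).
  rewrite -(fineK (fm1' A mA)) -(fineK (fm2' A mA)).
  by rewrite -!EFinD; congr EFin => /=; lra.
Qed.

Lemma Rintegral_mscale (m : {measure set T -> \bar R}) (k : {nonneg R}) f :
  fin_num_fun m -> measurable_fun setT f -> [bounded f x | x in setT] ->
  \int[mscale k m]_x f x = k%:num * \int[m]_x f x.
Proof.
move=> fm mf bf.
have fi := bounded_finite_integrable fm mf bf.
have mEf : measurable_fun setT (EFin \o f) by exact/measurable_EFinP.
rewrite /Rintegral integralE [in RHS]integralE.
rewrite !ge0_integral_mscale //; [|exact: measurable_funeneg|exact: measurable_funepos].
rewrite -muleBr ?fineM //.
- by rewrite fin_numB integrable_pos_fin_num // integrable_neg_fin_num.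
- by rewrite fin_num_adde_defr // integrable_pos_fin_num.
Qed.

(** A nonnegative factor turns both measures of the pair into measures again; the change of sign,
    which swaps them, is [charge_RintegralN]. *)
Lemma charge_RintegralZ nu f (c : R) : 0 <= c ->
  measurable_fun setT f -> [bounded f x | x in setT] ->
  charge_Rintegral (cscale c nu) f = c * charge_Rintegral nu f.
Proof.
move=> c0 mf bf.
have [m1 [m2 [fm1 fm2 nuE ->]]] := charge_RintegralP nu => //.
pose k := NngNum c0.
rewrite (@charge_RintegralE _ _ _ _ (mscale k m1) (mscale k m2)) //.
- by rewrite !Rintegral_mscale // -mulrBr.
- by move=> A mA; rewrite /= /mscale fin_numM // fm1.
- by move=> A mA; rewrite /= /mscale fin_numM // fm2.
- move=> A mA; rewrite /= /mscale /cscale nuE // muleBr //.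
  by rewrite fin_num_adde_defr // fm1.
Qed.

Lemma charge_RintegralN nu f :
  measurable_fun setT f -> [bounded f x | x in setT] ->
  charge_Rintegral (copp nu) f = - charge_Rintegral nu f.
Proof.
move=> mf bf.
have [m1 [m2 [fm1 fm2 nuE ->]]] := charge_RintegralP nu => //.
rewrite (@charge_RintegralE _ _ _ _ m2 m1) ?opprB //.
by move=> A mA; rewrite /= /copp /= nuE // fin_num_oppeB ?fm2 // addeC.
Qed.

Lemma charge_Rintegral0 f :
  measurable_fun setT f -> [bounded f x | x in setT] ->
  charge_Rintegral (@czero _ T R) f = 0.
Proof.
move=> mf bf; rewrite (@charge_RintegralE _ _ _ _ mzero mzero) ?subrr //.
by move=> A mA; rewrite /= /czero sube0.
Qed.

End charge_Rintegral_linear.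

(** * Sublinearity of the total variation *)

Section total_variation2_theory.
Context d (T : measurableType d) (R : realType).
Implicit Types nu : {charge set T -> \bar R}.

(** Triangle inequality in the Euclidean plane; after squaring it reduces to the Cauchy-Schwarz
    inequality [cs]. *)
Lemma hypotD (a b c e : R) :
  Num.sqrt ((a + c) ^+ 2 + (b + e) ^+ 2) <=
  Num.sqrt (a ^+ 2 + b ^+ 2) + Num.sqrt (c ^+ 2 + e ^+ 2).
Proof.
set s := Num.sqrt (a ^+ 2 + _); set t := Num.sqrt (c ^+ 2 + _).
have s0 : 0 <= s by exact: sqrtr_ge0.
have t0 : 0 <= t by exact: sqrtr_ge0.
have s2 : s ^+ 2 = a ^+ 2 + b ^+ 2 by rewrite sqr_sqrtr // addr_ge0 ?sqr_ge0.
have t2 : t ^+ 2 = c ^+ 2 + e ^+ 2 by rewrite sqr_sqrtr // addr_ge0 ?sqr_ge0.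
have cs : a * c + b * e <= s * t.
  have [le0|/ltW ge0] := leP (a * c + b * e) 0; first exact: le_trans (mulr_ge0 _ _).
  rewrite -ler_sqr ?nnegrE ?mulr_ge0 // exprMn s2 t2 -subr_ge0.
  (* Lagrange's identity. *)
  rewrite (_ : _ - _ = (a * e - b * c) ^+ 2) ?sqr_ge0 //; ring.
rewrite -ler_sqr ?nnegrE ?sqrtr_ge0 ?addr_ge0 // sqr_sqrtr ?addr_ge0 ?sqr_ge0 //.
rewrite [leRHS]sqrrD s2 t2; nra.
Qed.

Lemma total_variation2_ge0 nu1 nu2 : (0 <= total_variation2 nu1 nu2)%E.
Proof.
apply: le_trans (ereal_sup_ubound _); last first.
  (* The trivial partition guarantees that the supremum is not taken over the empty set, where it
     would be -oo. *)
  exists (fun k => if k is 0%N then setT else set0); last by [].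
  split.
  - by case.
  - by apply/trivIsetP => -[|i] [|j] _ _ // _; rewrite ?setI0 ?set0I.
  - by apply/seteqP; split => // x _; exists 0%N.
by apply: nneseries_ge0 => k _ _; rewrite lee_fin sqrtr_ge0.
Qed.

Lemma total_variation2D nu1 nu2 nu1' nu2' :
  (total_variation2 (cadd nu1 nu1') (cadd nu2 nu2') <=
   total_variation2 nu1 nu2 + total_variation2 nu1' nu2')%E.
Proof.
apply: ge_ereal_sup => _ [E [mE tE UE] <-].
have lee_tv (mu1 mu2 : {charge set T -> \bar R}) :
    (\sum_(0 <= k <oo) (Num.sqrt (fine (mu1 (E k)) ^+ 2 + fine (mu2 (E k)) ^+ 2))%:E
     <= total_variation2 mu1 mu2)%E.
  by apply: ereal_sup_ubound; exists E.
apply: le_trans (leeD (lee_tv nu1 nu2) (lee_tv nu1' nu2')).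
rewrite -nneseriesD; [|by move=> k _ _; rewrite lee_fin sqrtr_ge0..].
apply: lee_nneseries => k _; first by rewrite lee_fin sqrtr_ge0.
rewrite /cadd /= !fineD ?fin_num_measure // -EFinD lee_fin.
exact: hypotD.
Qed.

Lemma total_variation2Z nu1 nu2 (c : R) : 0 <= c ->
  (total_variation2 (cscale c nu1) (cscale c nu2) <=
   c%:E * total_variation2 nu1 nu2)%E.
Proof.
move=> c0; apply: ge_ereal_sup => _ [E [mE tE UE] <-].
apply: (@le_trans _ _ (c%:E * \sum_(0 <= k <oo)
    (Num.sqrt (fine (nu1 (E k)) ^+ 2 + fine (nu2 (E k)) ^+ 2))%:E)%E).
  rewrite -nneseriesZl; last by move=> k _; rewrite lee_fin sqrtr_ge0.
  apply: lee_nneseries => k _; first by rewrite lee_fin sqrtr_ge0.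
  rewrite /cscale /= !fineM ?fin_num_measure // -EFinM lee_fin /=.
  by rewrite !exprMn -mulrDr sqrtrM ?sqr_ge0 // sqrtr_sqr ger0_norm.
by rewrite lee_wpmul2l ?lee_fin //; apply: ereal_sup_ubound; exists E.
Qed.

Lemma total_variation2N nu1 nu2 :
  (total_variation2 (copp nu1) (copp nu2) <= total_variation2 nu1 nu2)%E.
Proof.
apply: ge_ereal_sup => _ [E [mE tE UE] <-].
apply: ereal_sup_ubound; exists E => //; apply: eq_eseriesr => k _.
by rewrite /copp /= !fineN !sqrrN.
Qed.

Lemma total_variation2_0 : total_variation2 (@czero _ T R) (@czero _ T R) = 0%E.
Proof.
apply/eqP; rewrite eq_le total_variation2_ge0 andbT.
apply: ge_ereal_sup => _ [E [mE tE UE] <-].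
by rewrite eseries0 // => k _ _; rewrite /czero /= expr0n addr0 sqrtr0.
Qed.

End total_variation2_theory.

(** * The BV norm is a seminorm *)

Section BVnorm_theory.
Variable R : realType.
Implicit Types (u v : plane R -> R) (nu : {charge set (plane R) -> \bar R}).

Lemma test_function_measurable_bounded (phi : R * R -> R) : test_function phi ->
  measurable_fun [set: plane R] phi /\
  [bounded (phi : plane R -> R) x | x in [set: plane R]].
Proof.
move=> tphi; split.
  by apply: continuous_measurable_plane; exact: test_function_continuous.
have [M phiM] := test_function_bounded tphi.
by exists M; split; [exact: num_real|move=> N MN x _; exact: le_trans (ltW MN)].
Qed.

Lemma distributional_gradientD u v nu1 nu2 nu1' nu2' :
  u \in @L2 R -> v \in @L2 R ->
  distributional_gradient u nu1 nu2 -> distributional_gradient v nu1' nu2' ->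
  distributional_gradient (u + v) (cadd nu1 nu1') (cadd nu2 nu2').
Proof.
move=> uL vL gu gv phi tphi.
have [mphi bphi] := test_function_measurable_bounded tphi.
have [d1L d2L] := test_function_derive_L2 tphi.
have [u1 u2] := gu phi tphi; have [v1 v2] := gv phi tphi.
rewrite !charge_RintegralD // (opprD (charge_Rintegral nu1 phi)).
rewrite (opprD (charge_Rintegral nu2 phi)) -u1 -u2 -v1 -v2.
by split; under eq_Rintegral do rewrite mulrDl;
  rewrite RintegralD //; exact: Lfun2_mul_integrable.
Qed.

Lemma distributional_gradientZ u nu1 nu2 (c : R) : 0 <= c ->
  u \in @L2 R -> distributional_gradient u nu1 nu2 ->
  distributional_gradient (c *: u) (cscale c nu1) (cscale c nu2).
Proof.
move=> c0 uL gu phi tphi.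
have [mphi bphi] := test_function_measurable_bounded tphi.
have [d1L d2L] := test_function_derive_L2 tphi.
have [u1 u2] := gu phi tphi.
rewrite !charge_RintegralZ // -!mulrN -u1 -u2.
by split; under eq_Rintegral do rewrite -mulrA;
  rewrite RintegralZl //; exact: Lfun2_mul_integrable.
Qed.

Lemma distributional_gradientN u nu1 nu2 :
  u \in @L2 R -> distributional_gradient u nu1 nu2 ->
  distributional_gradient (- u) (copp nu1) (copp nu2).
Proof.
move=> uL gu phi tphi.
have [mphi bphi] := test_function_measurable_bounded tphi.
have [d1L d2L] := test_function_derive_L2 tphi.
have [u1 u2] := gu phi tphi.
rewrite !charge_RintegralN // -u1 -u2.
by split; under eq_Rintegral do rewrite mulNr -mulN1r;
  rewrite RintegralZl ?mulN1r //; exact: Lfun2_mul_integrable.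
Qed.

Lemma distributional_gradient0 :
  distributional_gradient (0 : plane R -> R) czero czero.
Proof.
move=> phi tphi; have [mphi bphi] := test_function_measurable_bounded tphi.
rewrite charge_Rintegral0 // oppr0.
by split; under eq_Rintegral do rewrite mul0r; rewrite /Rintegral integral0.
Qed.

Lemma BVnorm_ge0 u : (0 <= BVnorm u)%E.
Proof.
by apply: le_ereal_inf_tmp => _ [nu1 [nu2 [_ ->]]]; exact: total_variation2_ge0.
Qed.

(** [BVnorm] is an infimum over all gradients of [u]. Working with a gradient that is optimal up to
    [e] avoids any appeal to uniqueness of the gradient. *)
Lemma BVnorm_adherent u (e : R) : 0 < e -> (BVnorm u < +oo)%E ->
  exists nu1 nu2, distributional_gradient u nu1 nu2 /\
    (total_variation2 nu1 nu2 <= BVnorm u + e%:E)%E.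
Proof.
move=> e0 uoo; have [|tv [nu1 [nu2 [gu ->]]] /ltW tve] :=
    @lb_ereal_inf_adherent _ [set tv | exists nu1 nu2, distributional_gradient u
      nu1 nu2 /\ tv = total_variation2 nu1 nu2] _ e0.
  by rewrite ge0_fin_numE ?BVnorm_ge0.
by exists nu1, nu2.
Qed.

Lemma le_BVnorm u nu1 nu2 : distributional_gradient u nu1 nu2 ->
  (BVnorm u <= total_variation2 nu1 nu2)%E.
Proof. by move=> gu; apply: ereal_inf_lbound; exists nu1, nu2. Qed.

Lemma BVnorm0 : BVnorm (0 : plane R -> R) = 0%E.
Proof.
apply/eqP; rewrite eq_le BVnorm_ge0 andbT.
by rewrite (le_trans (le_BVnorm distributional_gradient0)) // total_variation2_0.
Qed.

Lemma BVnormD u v : u \in @L2 R -> v \in @L2 R ->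
  (BVnorm (u + v)%R <= BVnorm u + BVnorm v)%E.
Proof.
move=> uL vL.
(* An infinite summand makes the right side +oo, because the other one is not -oo. *)
have [uoo|] := ltP (BVnorm u) +oo%E; last first.
  rewrite leye_eq => /eqP ->; rewrite addye ?leey //.
  by rewrite gt_eqF // (lt_le_trans _ (BVnorm_ge0 v)).
have [voo|] := ltP (BVnorm v) +oo%E; last first.
  rewrite leye_eq => /eqP ->; rewrite addey ?leey //.
  by rewrite gt_eqF // (lt_le_trans _ (BVnorm_ge0 u)).
apply/lee_addgt0Pr => e e0; have e20 : 0 < e / 2 by rewrite divr_gt0.
have [nu1 [nu2 [gu ue]]] := BVnorm_adherent e20 uoo.
have [nu1' [nu2' [gv ve]]] := BVnorm_adherent e20 voo.
apply: (le_trans (le_BVnorm (distributional_gradientD uL vL gu gv))).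
apply: (le_trans (total_variation2D _ _ _ _)).
apply: (le_trans (leeD ue ve)).
by rewrite addeACA -EFinD -splitr.
Qed.

Lemma BVnormZ u (c : R) : 0 <= c -> u \in @L2 R -> (BVnorm u < +oo)%E ->
  (BVnorm (c *: u)%R <= c%:E * BVnorm u)%E.
Proof.
move=> c0 uL uoo; apply/lee_addgt0Pr => e e0.
have c10 : 0 < c + 1 by rewrite ltr_wpDl.
(* With this tolerance the error [c * (e / (c + 1))] is at most [e], also when [c] is 0. *)
have e'0 : 0 < e / (c + 1) by rewrite divr_gt0.
have [nu1 [nu2 [gu ue]]] := BVnorm_adherent e'0 uoo.
apply: (le_trans (le_BVnorm (distributional_gradientZ c0 uL gu))).
apply: (le_trans (total_variation2Z _ _ c0)).
apply: (le_trans (lee_wpmul2l _ ue)); first by rewrite lee_fin.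
rewrite ge0_muleDr ?BVnorm_ge0 ?lee_fin ?(ltW e'0) // leeD2l // -EFinM lee_fin.
by rewrite mulrCA ger_pMr // ler_pdivrMr // mul1r lerDl.
Qed.

Lemma BVnormN u : u \in @L2 R -> (BVnorm (- u)%R <= BVnorm u)%E.
Proof.
move=> uL; apply: le_ereal_inf_tmp => _ [nu1 [nu2 [gu ->]]].
apply: (le_trans (le_BVnorm (distributional_gradientN uL gu))).
exact: total_variation2N.
Qed.

End BVnorm_theory.

(** * Indicator functions of rectangles *)

(** Each charge is a difference of two finite measures. On every piece of a partition the Euclidean
    norm is at most the sum of the four measures, and these add up to their total mass. So the
    existence of a gradient already gives a finite [BVnorm]. *)
Lemma total_variation2_lty d (T : measurableType d) (R : realType)
    (nu1 nu2 : {charge set T -> \bar R}) : (total_variation2 nu1 nu2 < +oo)%E.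
Proof.
have [m1 [m2 [fm1 fm2 nu1E _]]] := charge_RintegralP nu1.
have [m3 [m4 [fm3 fm4 nu2E _]]] := charge_RintegralP nu2.
pose m := [the {measure set T -> \bar R} of
  measure_add (measure_add m1 m2) (measure_add m3 m4)].
have mE A : m A = (m1 A + m2 A + (m3 A + m4 A))%E.
  by rewrite [LHS]measure_addE; congr (_ + _)%E; exact: measure_addE.
apply: (@le_lt_trans _ _ (m setT)); last first.
  by rewrite mE !lte_add_pinfty // ltey_eq ?fm1 ?fm2 ?fm3 ?fm4.
apply: ge_ereal_sup => _ [E [mE' tE UE] <-].
rewrite -UE measure_bigcup //.
rewrite [leRHS](_ : _ = \sum_(0 <= k <oo) m (E k))%E; last first.
  by apply: eq_eseriesl => k; rewrite in_setT.
apply: lee_nneseries => k _; first by rewrite lee_fin sqrtr_ge0.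
have mk := mE' k; rewrite mE nu1E // nu2E //.
have x0 := fine_ge0 (measure_ge0 m1 (E k)).
have y0 := fine_ge0 (measure_ge0 m2 (E k)).
have z0 := fine_ge0 (measure_ge0 m3 (E k)).
have t0 := fine_ge0 (measure_ge0 m4 (E k)).
rewrite -(fineK (fm1 _ mk)) -(fineK (fm2 _ mk)).
rewrite -(fineK (fm3 _ mk)) -(fineK (fm4 _ mk)) /=.
move: (fine (m1 _)) (fine (m2 _)) (fine (m3 _)) (fine (m4 _)) x0 y0 z0 t0.
move=> x y z t x0 y0 z0 t0; rewrite lee_fin; have s0 : 0 <= x + y + (z + t) by lra.
rewrite -ler_sqr ?nnegrE ?sqrtr_ge0 // sqr_sqrtr ?addr_ge0 ?sqr_ge0 //.
nra.
Qed.

(** The complement of [D] is null for the restricted measure, and on subsets of [D] the two measures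
    agree. *)
Lemma Rintegral_mrestr d (T : measurableType d) (R : realType)
    (mu : {measure set T -> \bar R}) (D : set T) (mD : measurable D) (f : T -> R) :
  (mrestr mu mD).-integrable setT (EFin \o f) ->
  \int[mrestr mu mD]_x f x = \int[mu]_(x in D) f x.
Proof.
move=> fi; rewrite /Rintegral; congr fine.
rewrite (@negligible_integral _ _ _ _ setT (~` D)) //; last 2 first.
- exact: measurableC.
- by rewrite /= /mrestr setICl measure0.
rewrite setTD setCK; apply: eq_measure_integral => A mA AD.
by rewrite /= /mrestr setIidl.
Qed.

(** The charge is the difference of the images of Lebesgue measure on [J] under [g1] and [g2]. These
    maps will parametrize opposite sides of a rectangle. *)
Lemma curve_charge (R : realType) d (T : measurableType d)
    (g1 g2 : measurableTypeR R -> T) (J : set (measurableTypeR R)) :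
  measurable_fun setT g1 -> measurable_fun setT g2 ->
  measurable J -> (lebesgue_measure J < +oo :> \bar R)%E ->
  exists nu : {charge set T -> \bar R}, forall f : T -> R,
    measurable_fun setT f -> [bounded f x | x in setT] ->
    charge_Rintegral nu f =
    \int[lebesgue_measure]_(t in J) f (g1 t) -
    \int[lebesgue_measure]_(t in J) f (g2 t).
Proof.
move=> mg1 mg2 mJ Joo.
pose mu := mrestr (@lebesgue_measure R) mJ.
have fmu : fin_num_fun mu.
  move=> A mA; rewrite /mu /= /mrestr ge0_fin_numE //.
  apply: le_lt_trans Joo; apply: le_measure; rewrite ?inE //.
  exact: measurableI.
pose c : {charge set (measurableTypeR R) -> \bar R} :=
  charge_of_finite_measure (mfrestr mJ Joo).
pose nu : {charge set T -> \bar R} :=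
  cadd (pushforward c g1) (copp (pushforward c g2)).
pose m1 : {measure set T -> \bar R} := pushforward mu g1.
pose m2 : {measure set T -> \bar R} := pushforward mu g2.
exists (nu mg1 mg2) => f mf bf.
rewrite (@charge_RintegralE _ _ _ _ (m1 mg1) (m2 mg2)) //.
- have step (g : measurableTypeR R -> T) (mg : measurable_fun setT g)
      (m : {measure set T -> \bar R}) : m = pushforward mu g :> (set T -> \bar R) ->
      \int[m]_x f x = \int[lebesgue_measure]_(t in J) f (g t).
    move=> mE.
    have fgi : mu.-integrable setT (EFin \o (f \o g)).
      apply: bounded_finite_integrable => //; first exact: measurableT_comp.
      by move: bf => [M [Mr fM]]; exists M; split=> // N /fM fN x _; exact: fN.
    pose pm : {measure set T -> \bar R} := pushforward mu g.
    rewrite -(Rintegral_mrestr fgi) /Rintegral.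
    rewrite (eq_measure_integral (pm mg)); last by move=> A _ _; rewrite mE.
    by rewrite integral_pushforward //; exact/measurable_EFinP.
  by rewrite (step g1) // (step g2).
- by move=> A mA; apply: fmu; rewrite -[X in measurable X]setTI; exact: mg1.
- by move=> A mA; apply: fmu; rewrite -[X in measurable X]setTI; exact: mg2.
Qed.

(** The second hypothesis says that [gam] is a line with velocity [e]. Difference quotients of
    [phi \o gam] are then those of [phi] in direction [e], and the fundamental theorem of calculus
    applies. *)
Lemma Rintegral_derive_line (R : realType) (phi : R * R -> R) (e : R * R)
    (gam : R -> R * R) (a b : R) :
  continuous gam -> (forall h x, gam (h + x) = h *: e + gam x) ->
  continuous phi -> (forall p, derivable phi p e) -> continuous ('D_e phi) ->
  a < b ->
  (\int[lebesgue_measure]_(x in `]a, b]) ('D_e phi (gam x))%:E =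
   (phi (gam b) - phi (gam a))%:E)%E.
Proof.
move=> cg gamD cphi dphi cdphi ab.
have quotE x :
    (fun h : R => h^-1 *: ((phi \o gam) (h *: (1 : R) + x) - (phi \o gam) x)) =
    (fun h => h^-1 *: (phi (h *: e + gam x) - phi (gam x))).
  by apply/funext => h /=; rewrite gamD [h *: 1]mulr1.
have cD : continuous (fun x => 'D_e phi (gam x)).
  by move=> x; apply: (@continuous_comp _ _ _ gam ('D_e phi) x (cg x) (cdphi _)).
have cphig : continuous (phi \o gam).
  by move=> x; apply: (@continuous_comp _ _ _ gam phi x (cg x) (cphi _)).
rewrite integral_itv_obnd_cbnd; last first.
  by apply/measurable_EFinP; apply: measurable_funTS; apply: continuous_measurable_fun.
rewrite (@continuous_FTC2 _ _ (phi \o gam)) //.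
- exact: continuous_subspaceT.
- split.
  + by move=> x _; rewrite /derivable quotE; exact: dphi.
  + by apply: cvg_at_right_filter; apply: cphig.
  + by apply: cvg_at_left_filter; apply: cphig.
- by move=> x _; rewrite derive1E /derive quotE.
Qed.

Section rectangle.
Variable R : realType.
Local Notation mu := (@lebesgue_measure R).

Lemma lebesgue_itv_lty (a b : R) : (mu `]a, b] < +oo)%E.
Proof. by rewrite lebesgue_measure_itv /=; case: ifP => // _; rewrite -EFinB ltry. Qed.

Lemma Rintegral_indic_mul (D : set (measurableTypeR R)) (k : R -> R) :
  \int[mu]_x (\1_D x * k x) = \int[mu]_(x in D) k x.
Proof.
rewrite [RHS]Rintegral_mkcond; apply: eq_Rintegral => x _.
by rewrite /patch indicE; case: ifP => _; rewrite ?mul1r ?mul0r.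
Qed.

Lemma indic_L2 (A : set (plane R)) : measurable A -> (lebesgue2 R A < +oo)%E ->
  \1_A \in @L2 R.
Proof.
move=> mA Aoo; apply: (@bounded_Lfun2 _ (plane R) R (lebesgue2 R) _ A 1) => //.
- by move=> x; rewrite indicE normr_nat; case: (_ \in _); rewrite ?ler01.
- by move=> x Ax; rewrite indicE memNset.
Qed.

Lemma lebesgue2_rectangle_lty (a b c e : R) :
  (lebesgue2 R (`]a, b]%classic `*` `]c, e]%classic) < +oo)%E.
Proof.
rewrite lebesgue2X; [|exact: measurable_itv..].
by rewrite lte_mul_pinfty ?lebesgue_itv_lty // ge0_fin_numE ?lebesgue_itv_lty.
Qed.

Lemma measurable_rectangle (a b c e : R) :
  measurable (`]a, b]%classic `*` `]c, e]%classic : set (plane R)).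
Proof. by apply: measurableX; exact: measurable_itv. Qed.

Lemma rectangle_L2 (a b c e : R) :
  \1_(`]a, b]%classic `*` `]c, e]%classic) \in @L2 R.
Proof.
by apply: indic_L2; [exact: measurable_rectangle|exact: lebesgue2_rectangle_lty].
Qed.

Lemma continuous_integrable_itv (a b : R) (k : R -> R) : continuous k ->
  mu.-integrable `]a, b] (EFin \o k).
Proof.
move=> ck; apply: (@integrableS _ (measurableTypeR R) R mu `[a, b]%classic) => //.
  by apply: subset_itvr; rewrite bnd_simp.
apply: continuous_compact_integrable; first exact: segment_compact.
exact: continuous_subspaceT.
Qed.

Lemma continuous_pairl (y : R) : continuous (fun x : R => (x, y)).
Proof. by move=> x; exact: (cvg_pair cvg_id (cvg_cst y)). Qed.

Lemma continuous_pairr (x : R) : continuous (fun y : R => (x, y)).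
Proof. by move=> y; exact: (cvg_pair (cvg_cst x) cvg_id). Qed.

Lemma indicX (I J : set (measurableTypeR R)) x y :
  \1_(I `*` J) (x, y) = \1_I x * \1_J y :> R.
Proof. by rewrite !indicE in_setX -mulnb natrM. Qed.

Lemma integral_indic_mul (D : set (measurableTypeR R)) (k : R -> R) :
  (\int[mu]_x (\1_D x * k x)%:E = \int[mu]_(x in D) (k x)%:E)%E.
Proof.
rewrite [RHS]integral_mkcond; apply: eq_integral => x _.
by rewrite /patch indicE; case: ifP => _; rewrite ?mul1r ?mul0r.
Qed.

(** Fubini with the first coordinate innermost: the inner integral is [phi (b, y) - phi (a, y)] for
    [y] in []c, e]] and 0 otherwise. The right side is written as minus the integral against a
    charge that is positive on the side over [a] and negative on the side over [b]. *)
Lemma rectangle_integral1 (a b c e : R) (phi : R * R -> R) :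
  a < b -> test_function phi ->
  \int[lebesgue2 R]_p (\1_(`]a, b]%classic `*` `]c, e]%classic) p * 'D_(e1 R) phi p) =
  - (\int[mu]_(y in `]c, e]) phi (a, y) - \int[mu]_(y in `]c, e]) phi (b, y)).
Proof.
move=> ab tphi; have [d1L _] := test_function_derive_L2 tphi.
have [cphi dphi _ cdphi _] := tphi.1 1.
have fi := Lfun2_mul_integrable (rectangle_L2 a b c e) d1L.
rewrite {1}/Rintegral -(integral21_prod_meas1 fi) /fubini_G /=.
have inner y : (\int[mu]_x (\1_(`]a, b]%classic `*` `]c, e]%classic) (x, y)
      * 'D_(e1 R) phi (x, y))%:E =
    (\1_(`]c, e]%classic : set (measurableTypeR R)) y *
      (phi (b, y) - phi (a, y)))%:E)%E.
  under eq_integral => x _ do rewrite indicX.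
  have [yJ|yJ] := boolP (y \in (`]c, e]%classic : set (measurableTypeR R))); last first.
    rewrite [in RHS]indicE (negbTE yJ) mul0r.
    rewrite integral0_eq // => x _.
    by rewrite [\1_(`]c, e]%classic) y]indicE (negbTE yJ) mulr0 mul0r.
  under eq_integral => x _ do rewrite [\1_(`]c, e]%classic) y]indicE yJ mulr1.
  rewrite (integral_indic_mul _ (fun x => 'D_(e1 R) phi (x, y))).
  rewrite (@Rintegral_derive_line _ phi (e1 R) (fun x => (x, y))) //.
  - by rewrite [in RHS]indicE yJ mul1r.
  - exact: continuous_pairl.
  - by move=> h x; congr pair; rewrite /= ?[h *: 1]mulr1 // [h *: 0]mulr0 add0r.
under eq_integral => y _ do rewrite inner.
rewrite -/(Rintegral _ _ _) Rintegral_indic_mul RintegralB //.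
- by rewrite opprB.
- apply: continuous_integrable_itv => y; apply: (@continuous_comp _ _ _ (pair b) phi).
    exact: continuous_pairr.
  exact: cphi.
- apply: continuous_integrable_itv => y; apply: (@continuous_comp _ _ _ (pair a) phi).
    exact: continuous_pairr.
  exact: cphi.
Qed.

Lemma rectangle_integral2 (a b c e : R) (phi : R * R -> R) :
  c < e -> test_function phi ->
  \int[lebesgue2 R]_p (\1_(`]a, b]%classic `*` `]c, e]%classic) p * 'D_(e2 R) phi p) =
  - (\int[mu]_(x in `]a, b]) phi (x, c) - \int[mu]_(x in `]a, b]) phi (x, e)).
Proof.
move=> ce tphi; have [_ d2L] := test_function_derive_L2 tphi.
have [cphi _ dphi _ cdphi] := tphi.1 1.
have fi := Lfun2_mul_integrable (rectangle_L2 a b c e) d2L.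
rewrite {1}/Rintegral -(integral12_prod_meas1 fi) /fubini_F /=.
have inner x : (\int[mu]_y (\1_(`]a, b]%classic `*` `]c, e]%classic) (x, y)
      * 'D_(e2 R) phi (x, y))%:E =
    (\1_(`]a, b]%classic : set (measurableTypeR R)) x *
      (phi (x, e) - phi (x, c)))%:E)%E.
  under eq_integral => y _ do rewrite indicX.
  have [xI|xI] := boolP (x \in (`]a, b]%classic : set (measurableTypeR R))); last first.
    rewrite [in RHS]indicE (negbTE xI) mul0r.
    rewrite integral0_eq // => y _.
    by rewrite [\1_(`]a, b]%classic) x]indicE (negbTE xI) !mul0r.
  under eq_integral => y _ do rewrite [\1_(`]a, b]%classic) x]indicE xI mul1r.
  rewrite (integral_indic_mul _ (fun y => 'D_(e2 R) phi (x, y))).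
  rewrite (@Rintegral_derive_line _ phi (e2 R) (fun y => (x, y))) //.
  - by rewrite [in RHS]indicE xI mul1r.
  - exact: continuous_pairr.
  - by move=> h y; congr pair; rewrite /= ?[h *: 1]mulr1 // [h *: 0]mulr0 add0r.
under eq_integral => x _ do rewrite inner.
rewrite -/(Rintegral _ _ _) Rintegral_indic_mul RintegralB //.
- by rewrite opprB.
- apply: continuous_integrable_itv => x; apply: (@continuous_comp _ _ _ (pair^~ e) phi).
    exact: continuous_pairl.
  exact: cphi.
- apply: continuous_integrable_itv => x; apply: (@continuous_comp _ _ _ (pair^~ c) phi).
    exact: continuous_pairl.
  exact: cphi.
Qed.

(** The gradient is length measure on the boundary times the inward normal: the vertical sides carry
    the first component, the horizontal sides the second. *)
Lemma BVnorm_rectangle_lty (a b c e : R) :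
  (BVnorm (\1_(`]a, b]%classic `*` `]c, e]%classic))%R < +oo)%E.
Proof.
have empty (S : set (plane R)) : S = set0 -> (BVnorm (\1_S)%R < +oo)%E.
  by move=> ->; rewrite indic0 BVnorm0 ltry.
have [ab|ba] := ltP a b; last first.
  by apply: empty; rewrite set_itv_ge ?set0X // bnd_simp -leNgt.
have [ce|ec] := ltP c e; last first.
  by apply: empty; rewrite [X in _ `*` X]set_itv_ge ?setX0 // bnd_simp -leNgt.
have mp1 x : measurable_fun setT ((fun y => (x, y)) : measurableTypeR R -> plane R).
  exact: (@pair1_measurable _ _ (measurableTypeR R) (measurableTypeR R)).
have mp2 y : measurable_fun setT ((fun x => (x, y)) : measurableTypeR R -> plane R).
  exact: (@pair2_measurable _ _ (measurableTypeR R) (measurableTypeR R)).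
have [nu1 nu1E] := curve_charge (mp1 a) (mp1 b)
  (measurable_itv `]c, e]) (lebesgue_itv_lty c e).
have [nu2 nu2E] := curve_charge (mp2 c) (mp2 e)
  (measurable_itv `]a, b]) (lebesgue_itv_lty a b).
apply: (@le_lt_trans _ _ (total_variation2 nu1 nu2)); last exact: total_variation2_lty.
apply: le_BVnorm => phi tphi.
have [mphi bphi] := test_function_measurable_bounded tphi.
rewrite nu1E // nu2E //; split.
  exact: rectangle_integral1.
exact: rectangle_integral2.
Qed.

End rectangle.

(** * Density of BV functions *)

Section BV_closure.
Variable R : realType.
Implicit Types (f g v : plane R -> R).

Definition BV_closure f := f \in @L2 R /\
  forall eps : R, 0 < eps -> exists v, [/\ v \in @L2 R, (BVnorm v < +oo)%E &
    \int[lebesgue2 R]_x ((f x - v x) ^+ 2) < eps].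

Lemma L2_sqr_integrable f : f \in @L2 R ->
  (lebesgue2 R).-integrable setT (EFin \o (fun x => f x ^+ 2)).
Proof. exact: Lfun2_integrable_sqr. Qed.

Lemma L2D f g : f \in @L2 R -> g \in @L2 R -> f + g \in @L2 R.
Proof.
move=> fL gL; have [_ H] := @Lfun_addr_closed _ _ _ (lebesgue2 R) _ (lee1_2 R).
exact: H.
Qed.

Lemma L2N f : f \in @L2 R -> - f \in @L2 R.
Proof. by move=> fL; exact: (@Lfun_oppr_closed _ _ R (lebesgue2 R) 2%:E). Qed.

Lemma L2B f g : f \in @L2 R -> g \in @L2 R -> f - g \in @L2 R.
Proof. by move=> fL gL; apply: L2D => //; exact: L2N. Qed.

Lemma L2_0 : (0 : plane R -> R) \in @L2 R.
Proof. by have [] := @Lfun_addr_closed _ _ _ (lebesgue2 R) _ (lee1_2 R). Qed.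

Lemma L2Z (c : R) f : f \in @L2 R -> c *: f \in @L2 R.
Proof.
move=> fL; have [_ H] := @Lfun_submod_closed _ _ _ (lebesgue2 R) _ (lee1_2 R).
by rewrite -[c *: f]addr0; apply: H => //; exact: L2_0.
Qed.

(** Pointwise [(x + y)^2 <= 2 x^2 + 2 y^2]; this plays the role of the triangle inequality for
    squared distances and explains the quarters of [eps] below. *)
Lemma sqr_sum_integral_le f g : f \in @L2 R -> g \in @L2 R ->
  \int[lebesgue2 R]_x ((f x + g x) ^+ 2) <=
  2 * \int[lebesgue2 R]_x (f x ^+ 2) + 2 * \int[lebesgue2 R]_x (g x ^+ 2).
Proof.
move=> fL gL.
have fi := L2_sqr_integrable fL; have gi := L2_sqr_integrable gL.
have f2i : (lebesgue2 R).-integrable setT (EFin \o (fun x => 2 * f x ^+ 2)).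
  by have := integrableZl measurableT 2 fi; apply: eq_integrable.
have g2i : (lebesgue2 R).-integrable setT (EFin \o (fun x => 2 * g x ^+ 2)).
  by have := integrableZl measurableT 2 gi; apply: eq_integrable.
rewrite -!RintegralZl // -RintegralD //.
apply: le_Rintegral => //.
- exact: L2_sqr_integrable (L2D fL gL).
- by have := integrableD measurableT f2i g2i; apply: eq_integrable.
- move=> x _; have := sqr_ge0 (f x - g x); nra.
Qed.

Lemma BV_closure_BV f : f \in @L2 R -> (BVnorm f < +oo)%E -> BV_closure f.
Proof.
move=> fL foo; split=> // eps eps0; exists f; split => //.
under eq_Rintegral do rewrite subrr expr0n.
by rewrite /Rintegral integral0.
Qed.

Lemma BV_closureD f g : BV_closure f -> BV_closure g -> BV_closure (f + g).
Proof.
move=> [fL af] [gL ag]; split; first exact: L2D.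
move=> eps eps0; have e0 : 0 < eps / 4 by rewrite divr_gt0.
have [v [vL voo fv]] := af _ e0; have [w [wL woo gw]] := ag _ e0.
exists (v + w); split; first exact: L2D.
  by rewrite (le_lt_trans (BVnormD vL wL)) // lte_add_pinfty.
rewrite (@eq_Rintegral _ _ _ _ _ (fun x => ((f - v) x + (g - w) x) ^+ 2)); last first.
  by move=> x _; rewrite !fctE; congr (_ ^+ 2); ring.
apply: le_lt_trans (sqr_sum_integral_le (L2B fL vL) (L2B gL wL)) _.
by rewrite !fctE; lra.
Qed.

Lemma BV_closureN f : BV_closure f -> BV_closure (- f).
Proof.
move=> [fL af]; split; first exact: L2N.
move=> eps eps0; have [v [vL voo fv]] := af _ eps0.
exists (- v); split; first exact: L2N.
  exact: le_lt_trans (BVnormN vL) voo.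
by under eq_Rintegral do rewrite !fctE -opprD sqrrN.
Qed.

Lemma BV_closureB f g : BV_closure f -> BV_closure g -> BV_closure (f - g).
Proof. by move=> af ag; apply: BV_closureD => //; exact: BV_closureN. Qed.

Lemma BV_closureZ (c : R) f : 0 <= c -> BV_closure f -> BV_closure (c *: f).
Proof.
move=> c0 [fL af]; split; first exact: L2Z.
(* Squared distances scale by [c ^+ 2]; the added 1 keeps the divisor positive when [c] is 0. *)
move=> eps eps0; have c20 : 0 < c ^+ 2 + 1 by rewrite ltr_wpDl ?sqr_ge0.
have [v [vL voo fv]] := af (eps / (c ^+ 2 + 1)) (divr_gt0 eps0 c20).
exists (c *: v); split; first exact: L2Z.
  apply: le_lt_trans (BVnormZ c0 vL voo) _.
  by rewrite lte_mul_pinfty // ?lee_fin // ge0_fin_numE // BVnorm_ge0.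
under eq_Rintegral do
  rewrite !fctE -[_ *: _]/(c * _) -[_ *: v _]/(c * _) -mulrBr exprMn.
rewrite RintegralZl //; last exact: L2_sqr_integrable (L2B fL vL).
move: fv; rewrite ltr_pdivlMr // => fv; apply: le_lt_trans fv.
rewrite mulrC ler_wpM2l //; last by rewrite lerDl.
by apply: Rintegral_ge0 => x _; exact: sqr_ge0.
Qed.

(** Dominated convergence brings some [g n] close to [f] in L^2, and [g n] is in turn close to a BV
    function. *)
Lemma BV_closure_lim f (g : nat -> plane R -> R) (h : plane R -> R) :
  f \in @L2 R -> (forall n, BV_closure (g n)) ->
  (lebesgue2 R).-integrable setT (EFin \o h) ->
  (forall n x, (f x - g n x) ^+ 2 <= h x) ->
  (forall x, g n x @[n --> \oo] --> f x) -> BV_closure f.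
Proof.
move=> fL ag hi gh gf; split=> // eps eps0.
have mf := Lfun2_measurable fL.
have mg n : measurable_fun setT (g n) by exact: (Lfun2_measurable (ag n).1).
have : (\int[lebesgue2 R]_x ((f x - g n x) ^+ 2)%:E)%E @[n --> \oo] -->
       (\int[lebesgue2 R]_x (cst 0 x))%E.
  apply: (@dominated_cvg _ _ _ _ _ _ _ _ (EFin \o h)) => //.
  - move=> n; apply/measurable_EFinP; apply: measurable_funX.
    exact: measurable_funB.
  - move=> x _; apply: cvg_EFin; first exact: nearW.
    have dc : f x - g n x @[n --> \oo] --> (0 : R).
      by have := cvgB (cvg_cst (f x)) (gf x); rewrite subrr; exact.
    by have := cvgM dc dc; rewrite mulr0; exact.
  - by move=> n x _ /=; rewrite lee_fin ger0_norm ?sqr_ge0.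
rewrite integral_cst // mul0e => cv.
have e40 : 0 < eps / 4 by rewrite divr_gt0.
have [n _ /(_ n (leqnn n)) /= fgn] := cvgr_lt _ (fine_cvg cv) _ e40.
have [gnL /(_ _ e40)[v [vL voo gv]]] := ag n.
exists v; split=> //.
rewrite (@eq_Rintegral _ _ _ _ _
  (fun x => ((f - g n) x + (g n - v) x) ^+ 2)); last first.
  by move=> x _; rewrite !fctE; congr (_ ^+ 2); ring.
apply: le_lt_trans (sqr_sum_integral_le (L2B fL gnL) (L2B gnL vL)) _.
move: fgn gv; rewrite -/(Rintegral _ _ _) !fctE; lra.
Qed.

End BV_closure.

(** * From rectangles to measurable sets *)

Section BV_closure_indic.
Variables (R : realType) (N : R).
Local Notation T1 := (measurableTypeR R).
Let side : set T1 := `]- N, N]%classic.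
Let box : set (plane R) := side `*` side.
(** Cutting down to a box of finite measure keeps every indicator in L^2, even that of the whole
    plane, so that the class can be closed under complements. *)
Let Q (S : set (plane R)) := BV_closure (\1_(S `&` box)).

Let mside : measurable side. Proof. exact: measurable_itv. Qed.
Let mbox : measurable box. Proof. exact: measurableX. Qed.

Let box_indic_L2 S : measurable S -> \1_(S `&` box) \in @L2 R.
Proof.
move=> mS; apply: indic_L2; first exact: measurableI.
apply: le_lt_trans (lebesgue2_rectangle_lty (- N) N (- N) N).
by apply: le_measure; rewrite ?inE //; exact: measurableI.
Qed.

Let indic_box S x : \1_(S `&` box) x = \1_S x * \1_box x :> R.
Proof. by rewrite !indicE (in_setI x S box) -mulnb natrM. Qed.

Let Q_diff S1 S2 : S1 `<=` S2 -> Q S1 -> Q S2 -> Q (S2 `\` S1).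
Proof.
move=> S12 Q1 Q2; rewrite /Q.
rewrite (_ : \1_((S2 `\` S1) `&` box) =
  \1_(S2 `&` box) - \1_(S1 `&` box) :> (plane R -> R)).
  exact: BV_closureB.
apply/funext => x; rewrite !fctE !indicE (in_setI x (S2 `\` S1)) in_setD.
rewrite (in_setI x S1) (in_setI x S2).
have : (x \in S1) ==> (x \in S2) by apply/implyP; rewrite !inE => /S12.
by case: (x \in S1); case: (x \in S2); case: (x \in box) => //= _;
  rewrite ?subr0 ?subrr.
Qed.

(** By disjointness the indicators of the partial unions are finite sums of indicators in the class.
    They converge pointwise, with errors dominated by the indicator of the box. *)
Let Q_bigcup (F : nat -> set (plane R)) : (forall n, measurable (F n)) ->
  trivIset setT F -> (forall n, Q (F n)) -> Q (\bigcup_n F n).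
Proof.
move=> mF tF QF.
pose g n : plane R -> R := \1_(\big[setU/set0]_(k < n) F k `&` box).
apply: (@BV_closure_lim _ _ g (fun x => \1_box x ^+ 2)).
- by apply: box_indic_L2; exact: bigcup_measurable.
- elim=> [|n IHn].
    rewrite /g big_ord0 set0I indic0.
    by apply: BV_closure_BV; [exact: L2_0|rewrite BVnorm0 ltry].
  rewrite /g (_ : \1_(\big[setU/set0]_(k < n.+1) F k `&` box) =
      g n + \1_(F n `&` box)); first by apply: BV_closureD => //; exact: QF.
  rewrite /g big_ord_recr /= setIUl.
  apply/funext => x; rewrite !fctE !indicE in_setU.
  have [xU|] := boolP (x \in _ `&` box) => /=; last by rewrite add0r.
  rewrite [x \in F n `&` box](_ : _ = false) ?addr0 //.
  apply/negbTE/negP; move: xU; rewrite !inE => -[xU _] [xF _].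
  move: xU; rewrite -bigcup_mkord => -[k /= kn xk].
  have /= kE : k = n := tF k n I I (ex_intro _ x (conj xk xF)).
  by rewrite kE ltnn in kn.
- by rewrite -[box]setTI; apply: L2_sqr_integrable; exact: box_indic_L2.
- move=> n x; rewrite /g !indic_box !indicE.
  case: (x \in box); case: (x \in \bigcup_k F k); case: (x \in _);
    by rewrite /= ?mulr0 ?mulr1 ?subr0 ?sub0r ?subrr ?sqrrN ?expr1n ?expr0n.
(* At each point the sequence is eventually constant: from [k.+1] on if [x] lies in [F k], and
   throughout if [x] lies in no [F k]. *)
- move=> x; apply: cvg_near_cst; have [[k _ xk]|nUx] := pselect ((\bigcup_n F n) x).
    exists k.+1 => // n /= kn; rewrite /g !indic_box !indicE; congr (_%:R * _).
    rewrite !mem_set //; first by exists k.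
    by rewrite -bigcup_mkord; exists k.
  apply: nearW => n; rewrite /g !indic_box !indicE; congr (_%:R * _).
  rewrite !memNset // -bigcup_mkord => -[k _ xk]; by apply: nUx; exists k.
Qed.

Let Q_setX (A B : set T1) : ocitv A -> ocitv B -> Q (A `*` B).
Proof.
move=> oA oB; rewrite /Q -setXI.
have ocside : ocitv side by exists (- N, N).
have [[a b] _ <-] := ocitvI oA ocside; have [[c e] _ <-] := ocitvI oB ocside.
by apply: BV_closure_BV; [exact: rectangle_L2|exact: BVnorm_rectangle_lty].
Qed.

Let Q_ext S S' : S `&` box = S' `&` box -> Q S -> Q S'.
Proof. by rewrite /Q => ->. Qed.

(** Dynkin's theorem is applied to one factor at a time, starting from half-open intervals: here to
    the first, with [B] still an interval, and in the next lemma to the second. *)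
Let Q_setX_measurable_oc (A B : set T1) : measurable A -> ocitv B -> Q (A `*` B).
Proof.
move=> mA oB; have ocside : ocitv side by exists (- N, N).
(* Inside the box the whole line is indistinguishable from the interval [side]. *)
have QTB : Q (setT `*` B).
  by apply: (Q_ext _ (Q_setX ocside oB)); rewrite -!setXI setTI setIid.
move: A mA; apply: (@dynkin_induction _ T1 (@ocitv R)) => //.
- exact: ocitvI.
- by move=> A oA; exact: Q_setX.
- move=> A mA QA; rewrite (_ : ~` A `*` B = (setT `*` B) `\` (A `*` B)).
    by apply: Q_diff => // -[x y] [].
  apply/seteqP; split => -[x y] /=; first by move=> [nA By]; split => // -[].
  by move=> [[_ By] nAB]; split => // Ax; exact: nAB.
- move=> F mF tF QF.
  rewrite (_ : _ `*` B = \bigcup_k (F k `*` B)); last first.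
    apply/seteqP; split => -[x y] /=; first by move=> [[k _ Fx] By]; exists k.
    by move=> [k _ [Fx By]]; split => //; exists k.
  apply: Q_bigcup => //.
  + move=> n; apply: measurableX => //.
    by apply: sub_sigma_algebra.
  + by move=> i j _ _ [[x y] [[xi _] [xj _]]]; apply: (tF i j I I); exists x.
Qed.

Let Q_setX_measurable (A B : set T1) : measurable A -> measurable B -> Q (A `*` B).
Proof.
move=> mA mB; have ocside : ocitv side by exists (- N, N).
have QTB : Q (A `*` setT).
  by apply: (Q_ext _ (Q_setX_measurable_oc mA ocside)); rewrite -!setXI setTI setIid.
move: B mB; apply: (@dynkin_induction _ T1 (@ocitv R)) => //.
- exact: ocitvI.
- by move=> B oB; exact: Q_setX_measurable_oc.
- move=> B mB QB; rewrite (_ : A `*` ~` B = (A `*` setT) `\` (A `*` B)).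
    by apply: Q_diff => // -[x y] [].
  apply/seteqP; split => -[x y] /=; first by move=> [Ax nB]; split => // -[].
  by move=> [[Ax _] nAB]; split => // By; exact: nAB.
- move=> F mF tF QF.
  rewrite (_ : A `*` _ = \bigcup_k (A `*` F k)); last first.
    apply/seteqP; split => -[x y] /=; first by move=> [Ax [k _ Fy]]; exists k.
    by move=> [k _ [Ax Fy]]; split => //; exists k.
  apply: Q_bigcup => //.
  + by move=> n; exact: measurableX.
  + by move=> i j _ _ [[x y] [[_ xi] [_ xj]]]; apply: (tF i j I I); exists y.
Qed.

(** A third use of Dynkin's theorem: products of measurable sets are stable under intersection and
    generate the product sigma-algebra. *)
Lemma BV_closure_indic (S : set (plane R)) : measurable S ->
  BV_closure (\1_(S `&` (`]- N, N]%classic `*` `]- N, N]%classic))).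
Proof.
rewrite -/side -/box -/(Q S) measurable_prod_measurableType.
move: S; apply: dynkin_induction.
- by rewrite measurable_prod_measurableType.
- move=> _ _ [A mA [B mB <-]] [A' mA' [B' mB' <-]].
  rewrite -setXI; exists (A `&` A'); first exact: measurableI.
  by exists (B `&` B') => //; exact: measurableI.
- by rewrite -setXTT; exact: Q_setX_measurable.
- by move=> _ [A mA [B mB <-]]; exact: Q_setX_measurable.
- move=> S mS QS; rewrite -setTD; apply: Q_diff => //.
  by rewrite -setXTT; exact: Q_setX_measurable.
- exact: Q_bigcup.
Qed.

End BV_closure_indic.

(** * From simple functions to L^2 *)

Section BV_dense.
Import HBNNSimple.
Variable R : realType.
Implicit Types f : plane R -> R.

Let box (N : R) : set (plane R) := `]- N, N]%classic `*` `]- N, N]%classic.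

Lemma BV_closure_nnsfun (h : {nnsfun plane R >-> R}) (N : R) :
  BV_closure (fun x => h x * \1_(box N) x).
Proof.
rewrite (_ : (fun x => _) = \sum_(y <- finmap.enum_fset (fset_set (range h)))
    y *: \1_(h @^-1` [set y] `&` box N)); last first.
  apply/funext => x; rewrite fimfunE fsbig_finite //= mulr_suml fct_sumE.
  apply: eq_bigr => y _; rewrite -mulrA; congr (_ * _).
  by rewrite !indicE in_setI -mulnb natrM.
(* [big_seq] records that each coefficient is a value of [h], hence nonnegative as [BV_closureZ]
   requires. *)
rewrite big_seq; apply: big_ind.
- by apply: BV_closure_BV; [exact: L2_0|rewrite BVnorm0 ltry].
- exact: BV_closureD.
- move=> y; rewrite in_fset_set // inE => -[x _ <-].
  apply: BV_closureZ; first exact: fun_ge0.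
  by apply: BV_closure_indic; rewrite -[X in measurable X]setTI; exact: measurable_funP.
Qed.

Lemma box_cvg (x : plane R) : \1_(box n%:R) x @[n --> \oo] --> (1 : R).
Proof.
case: x => x y; apply: cvg_near_cst.
exists (Num.bound (Num.max `|x| `|y|)) => // n /= kn.
have : Num.max `|x| `|y| < n%:R.
  by rewrite (lt_le_trans (archi_boundP _)) ?ler_nat // le_max normr_ge0.
rewrite gt_max !ltr_norml => /andP[/andP[x1 x2] /andP[y1 y2]].
by rewrite indicE mem_set //; split; rewrite /= in_itv /= ?x1 ?y1 ?(ltW x2) ?(ltW y2).
Qed.

(** Increasing simple approximations, cut off to growing boxes, stay between 0 and [f]; the squared
    errors are therefore dominated by [f ^+ 2]. *)
Lemma BV_dense_ge0 f : f \in @L2 R -> (forall x, 0 <= f x) -> BV_closure f.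
Proof.
move=> fL f0; have mf := Lfun2_measurable fL.
have mEf : measurable_fun setT (EFin \o f) by exact/measurable_EFinP.
pose s := nnsfun_approx measurableT mEf.
have sf n x : s n x <= f x.
  have := @le_approx _ _ R setT (EFin \o f) n x.
  rewrite -(nnsfun_approxE measurableT mEf) lee_fin.
  by apply => // y _; rewrite lee_fin.
apply: (@BV_closure_lim _ _ (fun n x => s n x * \1_(box n%:R) x)
  (fun x => f x ^+ 2)) => //.
- by move=> n; exact: BV_closure_nnsfun.
- exact: L2_sqr_integrable.
- move=> n x; have := sf n x; have : 0 <= s n x by [].
  have := f0 x; rewrite indicE; case: (_ \in _) => /=; nra.
- move=> x; rewrite -[X in _ --> X]mulr1; apply: cvgM; last exact: box_cvg.
  have f0' y : setT y -> (0 <= (EFin \o f) y)%E by rewrite lee_fin.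
  exact: fine_cvg (@cvg_nnsfun_approx _ _ R setT measurableT _ mEf f0' x I).
Qed.

Lemma BV_dense f : f \in @L2 R -> BV_closure f.
Proof.
move=> fL; have mf := Lfun2_measurable fL.
have le_L2 (g : plane R -> R) : measurable_fun setT g ->
    (forall x, g x ^+ 2 <= f x ^+ 2) -> g \in @L2 R.
  move=> mg gf; apply/Lfun2P; split=> //.
  have /Lfun2P[_] := fL; apply: le_lt_trans; apply: ge0_le_integral => //.
  - by move=> x _; rewrite lee_fin sqr_ge0.
  - by apply/measurable_EFinP; exact: measurable_funX.
  - by apply/measurable_EFinP; exact: measurable_funX.
  - by move=> x _; rewrite lee_fin.
rewrite -[f]funrposBneg; apply: BV_closureB; apply: BV_dense_ge0.
- apply: le_L2; first exact: measurable_funrpos.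
  by move=> x; rewrite /funrpos maxEle; case: ifP => //; rewrite expr0n sqr_ge0.
- by move=> x; exact: funrpos_ge0.
- apply: le_L2; first exact: measurable_funrneg.
  move=> x; rewrite /funrneg maxEle.
  by case: ifP => //; rewrite ?sqrrN // expr0n sqr_ge0.
- by move=> x; exact: funrneg_ge0.
Qed.

End BV_dense.

(** * The energy identity and the convergence of the residuals *)

(** The squared norm as a real number, so that energies can be computed in a field; [sqr_L2norm]
    ties it to [L2norm]. *)
Definition sqL2 (R : realType) (g : plane R -> R) : R :=
  \int[lebesgue2 R]_x (g x ^+ 2).

Section sqL2_theory.
Variable R : realType.
Implicit Types g h : plane R -> R.

Lemma sqL2_ge0 g : 0 <= sqL2 g.
Proof. by apply: Rintegral_ge0 => x _; exact: sqr_ge0. Qed.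

Lemma sqr_L2norm g : g \in @L2 R -> (L2norm g ^+ 2 = (sqL2 g)%:E)%E.
Proof. exact: Lnorm2_sqr_Rintegral. Qed.

Lemma L2normE g : g \in @L2 R -> (L2norm g = (Num.sqrt (sqL2 g))%:E)%E.
Proof.
move=> gL; have := sqr_L2norm gL.
have : (0 <= L2norm g)%E by exact: Lnorm_ge0.
case: (L2norm g) => [r r0|_|]; [|by rewrite expe2 mulyy|by rewrite leeNy_eq].
by rewrite -EFin_expe => -[<-]; rewrite sqrtr_sqr ger0_norm.
Qed.

Lemma sqL2D g h (t : R) : g \in @L2 R -> h \in @L2 R ->
  sqL2 (g + t *: h) =
  sqL2 g + 2 * t * \int[lebesgue2 R]_x (g x * h x) + t ^+ 2 * sqL2 h.
Proof.
move=> gL hL.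
have gi := L2_sqr_integrable gL; have hi := L2_sqr_integrable hL.
have ghi := Lfun2_mul_integrable gL hL.
have ghi' : (lebesgue2 R).-integrable setT (EFin \o (fun x => 2 * t * (g x * h x))).
  by have := integrableZl measurableT (2 * t) ghi; apply: eq_integrable.
have hi' : (lebesgue2 R).-integrable setT (EFin \o (fun x => t ^+ 2 * h x ^+ 2)).
  by have := integrableZl measurableT (t ^+ 2) hi; apply: eq_integrable.
rewrite /sqL2 -!RintegralZl // -!RintegralD //; last first.
  by have := integrableD measurableT gi ghi'; apply: eq_integrable.
apply: eq_Rintegral => x _; rewrite !fctE -[_ *: _]/(t * h x).
ring.
Qed.

End sqL2_theory.

(** First-variation principle: for small [t] of either sign the linear term dominates. The range
    [-1 <= t] corresponds to the multiples [(1 + t) u] with nonnegative factor. *)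
Lemma affine_quadratic_ge0 (R : realFieldType) (c K : R) : 0 <= K ->
  (forall t, -1 <= t -> 0 <= t * c + K * t ^+ 2) -> c = 0.
Proof.
move=> K0 H; have d0 : 0 < K + `|c| + 1 by rewrite ltr_wpDl // addr_ge0.
(* With [d = K + |c| + 1] this [t] is at least -1 and gives the value [- c^2 (d - K) / d^2], where
   [d - K = |c| + 1] is positive. *)
have := H (- c / (K + `|c| + 1)).
rewrite ler_pdivlMr // mulN1r lerN2.
have -> : c <= K + `|c| + 1 by have := ler_norm c; lra.
move=> /(_ isT).
set d := K + `|c| + 1.
have -> : - c / d * c + K * (- c / d) ^+ 2 = - (c ^+ 2 * (d - K) / d ^+ 2).
  by field; rewrite gt_eqF.
rewrite oppr_ge0 => le0; apply/eqP; rewrite -sqrf_eq0 eq_le sqr_ge0 andbT.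
move: le0; rewrite ler_pdivrMr ?exprn_gt0 // mul0r pmulr_lle0 //.
by rewrite /d; have := normr_ge0 c; lra.
Qed.

(** * Properties of a single minimizer *)

Section minimizer.
Variables (R : realType) (lambda : R) (g u : plane R -> R).
Hypotheses (lambda0 : 0 < lambda) (gL : g \in @L2 R).
Hypothesis hu : is_minimizer lambda g u.

Lemma functionalE (v : plane R -> R) : v \in @L2 R ->
  (functional lambda g v = (lambda * sqL2 (g - v))%:E + BVnorm v)%E.
Proof. by move=> vL; rewrite /functional sqr_L2norm ?EFinM //; exact: L2B. Qed.

(** The competitor 0 has finite energy. *)
Lemma minimizer_BVnorm : exists2 b : R, BVnorm u = b%:E & 0 <= b.
Proof.
have [uL /(_ 0 (L2_0 R))] := hu.
rewrite !functionalE // ?BVnorm0 ?adde0; last exact: L2_0.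
have := BVnorm_ge0 u; case: (BVnorm u) => [b b0 _||] //; by exists b.
Qed.

(** Minimality between real numbers. [B] is only an upper bound because the seminorm inequalities
    bound competitors from above. *)
Lemma minimizer_le (v : plane R -> R) (B b : R) : v \in @L2 R ->
  BVnorm u = b%:E -> (BVnorm v <= B%:E)%E ->
  lambda * sqL2 (g - u) + b <= lambda * sqL2 (g - v) + B.
Proof.
move=> vL ub vB; have [uL /(_ v vL)] := hu.
rewrite !functionalE // ub => /le_trans -/(_ _ (leeD2l _ vB)).
by rewrite -!EFinD lee_fin.
Qed.

Lemma minimizer_energy (b : R) : BVnorm u = b%:E ->
  sqL2 g = sqL2 (g - u) + b / lambda + sqL2 u.
Proof.
move=> ub; have [uL _] := hu; have rL := L2B gL uL.
have b0 : (0 <= b%:E)%E by rewrite -ub BVnorm_ge0.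
set i := \int[lebesgue2 R]_x ((g - u) x * u x).
(* Passing from [u] to [(1 + t) u] raises the energy by at most
   [t (b - 2 lambda i) + t^2 lambda |u|^2], which is therefore nonnegative for all [t >= -1]. *)
have E : b - 2 * lambda * i = 0.
  apply: (@affine_quadratic_ge0 _ _ (lambda * sqL2 u)).
    by rewrite mulr_ge0 ?sqL2_ge0 // ltW.
  move=> t t1; have t10 : 0 <= 1 + t by lra.
  have vB : (BVnorm ((1 + t) *: u)%R <= ((1 + t) * b)%:E)%E.
    by rewrite EFinM -ub; apply: BVnormZ => //; rewrite ub ltry.
  have := minimizer_le (L2Z _ uL) ub vB.
  have -> : g - (1 + t) *: u = (g - u) + (- t) *: u.
    by rewrite scalerDl scale1r opprD addrA scaleNr.
  rewrite (sqL2D _ rL uL) -/i; nra.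
have -> : b / lambda = 2 * i.
  by rewrite (_ : b = 2 * lambda * i); [field; rewrite gt_eqF|lra].
have {1}-> : g = (g - u) + 1 *: u by rewrite scale1r subrK.
by rewrite (sqL2D _ rL uL) -/i; ring.
Qed.

End minimizer.

Lemma bounded_sum_cvg0 (R : realType) (c : nat -> R) (M : R) :
  (forall n, 0 <= c n) -> (forall m, \sum_(n < m) c n <= M) ->
  c n @[n --> \oo] --> 0.
Proof.
move=> c0 cM; apply: cvg_series_cvg_0; apply: nondecreasing_is_cvgn.
  by apply: nondecreasing_series => n _ _; exact: c0.
by exists M => _ [m _ <-]; rewrite /series /= big_mkord.
Qed.

(** * The iterated decomposition *)

Section decomposition.
Variables (R : realType) (f : plane R -> R) (lambda0 : R) (u : nat -> plane R -> R).
Hypotheses (hf : f \in @L2 R) (hlambda0 : 0 < lambda0).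
Hypothesis hu : forall n : nat,
  is_minimizer (lambda0 * 2 ^+ n) (f - \sum_(j < n) u j) (u n).

Let lam n := lambda0 * 2 ^+ n.
Let r n := f - \sum_(j < n) u j.
Let b n := fine (BVnorm (u n)).

Let lam_gt0 n : 0 < lam n.
Proof. by rewrite mulr_gt0 // exprn_gt0. Qed.

Let uL n : u n \in @L2 R. Proof. by have [] := hu n. Qed.

Let sumL n : \sum_(j < n) u j \in @L2 R.
Proof. by elim/big_ind : _ => [|x y|i _]; [exact: L2_0|exact: L2D|exact: uL]. Qed.

Lemma residual_L2 n : f - \sum_(j < n) u j \in @L2 R.
Proof. exact: L2B. Qed.

Let rS n : r n.+1 = r n - u n.
Proof. by rewrite /r big_ord_recr /= opprD addrA. Qed.

Let BVu n : BVnorm (u n) = (b n)%:E.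
Proof. by rewrite /b; have [x ->] := minimizer_BVnorm (residual_L2 n) (hu n). Qed.

Let b_ge0 n : 0 <= b n.
Proof. by rewrite -lee_fin -BVu BVnorm_ge0. Qed.

Lemma energy_partial n :
  sqL2 f = sqL2 (f - \sum_(j < n) u j) + \sum_(j < n) (b j / lam j + sqL2 (u j)).
Proof.
rewrite -/(r n); elim: n => [|n ->]; first by rewrite /r !big_ord0 subr0 addr0.
rewrite (minimizer_energy (lam_gt0 n) (residual_L2 n) (hu n) (BVu n)) -/(r n) -rS.
by rewrite big_ord_recr /=; ring.
Qed.

Let BV_sum n : (BVnorm (\sum_(j < n) u j)%R <= (\sum_(j < n) b j)%:E)%E.
Proof.
elim: n => [|n IHn]; first by rewrite !big_ord0 BVnorm0.
rewrite !big_ord_recr /= EFinD (le_trans (BVnormD (sumL n) (uL n))) //.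
by rewrite BVu leeD2r.
Qed.

(** The competitor [v - \sum_(j < n) u j] leaves exactly the residual [f - v]. The term [b n] of the
    minimal energy is dropped, and the rest divided by [lam n]. *)
Lemma residual_le (v : plane R -> R) (B : R) n : v \in @L2 R -> BVnorm v = B%:E ->
  sqL2 (f - \sum_(j < n.+1) u j) <= sqL2 (f - v) + (B + \sum_(j < n) b j) / lam n.
Proof.
move=> vL vB; rewrite -/(r n.+1) rS.
have wL : v - \sum_(j < n) u j \in @L2 R by exact: L2B.
have wB : (BVnorm (v - \sum_(j < n) u j)%R <= (B + \sum_(j < n) b j)%:E)%E.
  rewrite EFinD -vB (le_trans (BVnormD vL (L2N (sumL n)))) // leeD2l //.
  exact: le_trans (BVnormN (sumL n)) (BV_sum n).
have := minimizer_le (residual_L2 n) (hu n) wL (BVu n) wB.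
rewrite -/(lam n) -/(r n).
have -> : r n - (v - \sum_(j < n) u j) = f - v by rewrite /r opprB addrA subrK.
move=> H; rewrite -(ler_pM2l (lam_gt0 n)) mulrDr mulrCA divff ?gt_eqF // mulr1.
by have := b_ge0 n; lra.
Qed.

Lemma dyadic_weights_cvg0 (B : R) : 0 <= B ->
  (B + \sum_(j < n) b j) / lam n @[n --> \oo] --> 0.
Proof.
move=> B0; pose c n := (B + \sum_(j < n) b j) / lam n.
have c_ge0 n : 0 <= c n.
  by rewrite divr_ge0 ?(ltW (lam_gt0 n)) // addr_ge0 // sumr_ge0.
have cS n : 2 * c n.+1 = c n + b n / lam n.
  have := lam_gt0 n; rewrite /c /lam big_ord_recr /= exprS => l0.
  by field; rewrite !gt_eqF // exprn_gt0.
(* The recursion [cS], summed over [n < m]. *)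
have sumc m : \sum_(n < m) c n + 2 * c m = \sum_(n < m) (b n / lam n) + 2 * c 0%N.
  elim: m => [|m IHm]; first by rewrite !big_ord0.
  by rewrite !big_ord_recr /= cS; move: IHm; lra.
apply: (@bounded_sum_cvg0 _ c (sqL2 f + 2 * c 0%N)) => // m.
have : \sum_(n < m) (b n / lam n) <= sqL2 f.
  rewrite (energy_partial m) big_split /= addrCA lerDl addr_ge0 ?sqL2_ge0 //.
  by apply: sumr_ge0 => j _; exact: sqL2_ge0.
by have := sumc m; have := c_ge0 m; lra.
Qed.

Lemma sqL2_residual_cvg0 : sqL2 (f - \sum_(j < n) u j) @[n --> \oo] --> 0.
Proof.
apply/cvgrPdist_lt => eps eps0.
have e20 : 0 < eps / 2 by rewrite divr_gt0.
have [v [vL voo fv]] := (BV_dense hf).2 _ e20.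
have [B vB] : exists B, BVnorm v = B%:E.
  by exists (fine (BVnorm v)); rewrite fineK // ge0_fin_numE ?BVnorm_ge0.
have B0 : 0 <= B by rewrite -lee_fin -vB BVnorm_ge0.
have [k _ kP] := cvgr_lt _ (dyadic_weights_cvg0 B0) _ e20.
(* The index is shifted because [residual_le] bounds the residual of index [n.+1] by the weight of
   index [n]. *)
exists k.+1 => // -[//|n] /= kn.
rewrite sub0r normrN ger0_norm ?sqL2_ge0 //.
apply: le_lt_trans (residual_le n vL vB) _; rewrite [ltRHS]splitr ltrD //.
exact: kP.
Qed.

End decomposition.

Theorem theorem2p2 (R : realType) (f : plane R -> R) (lambda0 : R)
    (u : nat -> plane R -> R)
    (hf : f \in @L2 R)
    (hlambda0 : 0 < lambda0)
    (hu : forall n : nat,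
      is_minimizer (lambda0 * 2 ^+ n) (f - \sum_(j < n) u j) (u n)) :
  (L2norm (f - \sum_(j < n) u j) @[n --> \oo] --> 0%E) /\
  (L2norm f ^+ 2 =
     \sum_(0 <= j <oo)
       ((lambda0 * 2 ^+ j)^-1%:E * BVnorm (u j) + L2norm (u j) ^+ 2))%E.
Proof.
have cv := sqL2_residual_cvg0 hf hlambda0 hu.
have rL := residual_L2 hf hu.
split.
  rewrite (_ : (fun n => _) =
    fun n => (Num.sqrt (sqL2 (f - \sum_(j < n) u j)))%:E); last first.
    by apply/funext => n; rewrite L2normE.
  apply: cvg_EFin; first exact: nearW.
  by rewrite -[X in _ --> X]sqrtr0; apply: continuous_cvg cv; exact: sqrt_continuous.
rewrite sqr_L2norm //; apply/esym/cvg_lim => //.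
(* By [energy_partial] the partial sums of the series are the energy of [f] minus that of the
   residual, which tends to 0. *)
rewrite (_ : (fun n => _) = fun n => (sqL2 f - sqL2 (f - \sum_(j < n) u j))%:E).
  apply: cvg_EFin; first exact: nearW.
  by rewrite -[X in _ --> X]subr0; apply: cvgB => //; exact: cvg_cst.
apply/funext => n; rewrite big_mkord.
rewrite {1}(energy_partial hf hlambda0 hu n) [X in (X - _)%:E]addrC addrK -sumEFin.
apply: eq_bigr => j _; have [uL _] := hu j.
have lam0 : 0 < lambda0 * 2 ^+ j by rewrite mulr_gt0 // exprn_gt0.
have [x ux _] := minimizer_BVnorm (rL j) (hu j).
by rewrite sqr_L2norm // ux -EFinM -EFinD /= mulrC.
Qed.
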